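(* Let $F_i=(f_i=0)$ and $G_i=(g_i=0)$, $i=1,\dots,4$, be two quadruples of hyperplanes in $\mathbb{P}^4$ (over $\mathbb{C}$) such that every intersection $\Pi_{ij}=F_i\cap G_j$ ($1\le i,j\le 4$) is a plane. Suppose that the four diagonal planes $\Pi_{11},\Pi_{22},\Pi_{33},\Pi_{44}$ are contained in a hyperplane $H=(h=0)$ with $H\ne F_i$ and $H\neq G_i$ for all $i$, and that the linear forms are rescaled so that $h=f_i+g_i$ for $i=1,\dots,4$. Then $h$ divides $f_1f_2f_3f_4-g_1g_2g_3g_4$, and the twelve residual planes $\Pi_{ij}=F_i\cap G_j$, $i\ne j$, are contained in the cubic threefold $$X:\quad \frac{f_1f_2f_3f_4-g_1g_2g_3g_4}{h}=0.$$ Equivalently, writing $e_r=e_r(f_1,f_2,f_3,f_4)$ for the $r$-th elementary symmetric polynomial, the equation of $X$ is $$e_3-h e_2+h^2 e_1-h^3=0,$$ that is, $$\begin{aligned}&f_1f_2f_3+f_1f_2f_4+f_1f_3f_4+f_2f_3f_4\\&-h(f_1f_2+f_1f_3+f_1f_4+f_2f_3+f_2f_4+f_3f_4)+h^2(f_1+f_2+f_3+f_4)-h^3=0.\end{aligned}$$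
   Context: $\mathbb{P}^4$ is complex projective 4-space; a plane is a 2-dimensional linear subspace. The $f_i,g_i,h$ are nonzero linear forms. Such a rescaling exists because $\Pi_{ii}\subset H$ and $H\neq F_i,G_i$. *)

(* Defs.v *)
From HB Require Import structures.
From mathcomp Require Import all_boot all_order all_algebra.
From mathcomp Require Import boolp classical_sets reals.
From mathcomp Require Import complex.
From mathcomp Require Import mpoly.

Set Implicit Arguments.
Unset Strict Implicit.
Unset Printing Implicit Defensive.

Import GRing.Theory.

Local Open Scope classical_set_scope.
Local Open Scope ring_scope.

(* Projective n-space over K as the type of lines of K^(n+1). *)
Definition projspace (K : fieldType) (n : nat) :=
  {L : {vspace 'rV[K]_n.+1} | \dim L == 1%N}.

Definition projlin (K : fieldType) (n : nat) (W : {vspace 'rV[K]_n.+1}) :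
    set (projspace K n) :=
  [set x | (val x <= W)%VS].

(* The linear dimension is one more than the projective one. *)
Definition is_plane (K : fieldType) (n : nat) (S : set (projspace K n)) :=
  exists2 W : {vspace 'rV[K]_n.+1}, \dim W = 3%N & S = projlin W.

(* Meaningful for homogeneous p only; then vanishing at one nonzero vector of
   the line is the same as vanishing on the whole line. *)
Definition projzeros (K : fieldType) (n : nat) (p : {mpoly K[n.+1]}) :
    set (projspace K n) :=
  [set x : projspace K n | forall v : 'rV[K]_n.+1, v \in val x -> p.@[v 0] = 0].

Definition mpoly_dvd (K : fieldType) (n : nat) (p q : {mpoly K[n]}) :=
  exists r : {mpoly K[n]}, q = p * r.

Definition elem_sym (K : fieldType) (n m r : nat) (f : 'I_m -> {mpoly K[n]}) :
    {mpoly K[n]} :=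
  mesym m K r \mPo [tuple f i | i < m].

(* Main.v *)
Require Import Defs.
From HB Require Import structures.
From mathcomp Require Import all_boot all_order all_algebra.
From mathcomp Require Import boolp classical_sets reals.
From mathcomp Require Import complex.
From mathcomp Require Import mpoly.
From mathcomp Require Import ring.

(** Write [p(f, h)] for the cubic form in the last conclusion. Since
    [g i = h - f i], expanding the product of the [h - f i] in powers of [h]
    gives [\prod_i f i] as its term of degree 0 in [h]; the other terms are
    divisible by [h], with alternating elementary symmetric polynomials as
    coefficients. Hence [\prod_i f i - \prod_i g i = h * p(f, h)], and as
    polynomials form a domain, the quotient by [h] is unique. The explicit
    expansion is [prod_sub_prod_cubic], the one in terms of [elem_sym] is
    [prod_sub_prod_elem_sym4], which follows from Viete's formula; since
    [h] can be cancelled from both, no [elem_sym 2] or [elem_sym 3] has to be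
    written out.

    At a point of a residual plane, [f i = 0] and [g j = 0], so that
    [f j = h]; substituting both values in the cubic gives 0
    ([cubic_residual]). The direct argument, that the left-hand side vanishes
    and [h] can be cancelled, breaks down at the points of [H].

    The cubic is homogeneous by inspection. If it were zero, [f 0] would divide
    [\prod_j g j]. But no [g j] vanishes on the whole hyperplane [f 0 = 0],
    which would otherwise be contained in a plane
    ([projzeros_not_subset]), and a linear form generates a prime ideal
    ([linear_form_ndvd_prod]). *)

Set Implicit Arguments.
Unset Strict Implicit.
Unset Printing Implicit Defensive.

Import GRing.Theory.

Local Open Scope classical_set_scope.
Local Open Scope ring_scope.

(** * Linear forms *)

Lemma linear_form_expand (n : nat) (A : nzRingType) (p : {mpoly A[n]}) :
  p \is 1.-homog -> p = \sum_(i < n) p@_U_(i) *: 'X_i.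
Proof.
move=> p_lin; apply/mpolyP => m; rewrite raddf_sum /=.
under eq_bigr => i _ do rewrite mcoeffZ mcoeffX.
have [/mdeg1P [j /eqP ->]|m_neq1] := boolP (mdeg m == 1%N).
  rewrite (bigD1 j) //= eqxx mulr1 big1 ?addr0 // => i ne_ij.
  by rewrite eq_mnm1 (negbTE ne_ij) mulr0.
rewrite (dhomog_nemf_coeff p_lin m_neq1) big1 // => i _.
have [m_eq|] := eqVneq; last by rewrite mulr0.
by rewrite -m_eq mdeg1 in m_neq1.
Qed.

Lemma mmap_linear_form (n : nat) (A : nzRingType) (B : comNzRingType)
    (phi : {rmorphism A -> B}) (w : 'I_n -> B) (p : {mpoly A[n]}) :
  p \is 1.-homog -> mmap phi w p = \sum_(i < n) phi p@_U_(i) * w i.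
Proof.
move=> p_lin; rewrite {1}(linear_form_expand p_lin) raddf_sum /=.
by apply: eq_bigr => i _; rewrite mmapZ mmapX mmap1U.
Qed.

Lemma meval_linear_form (n : nat) (A : comNzRingType) (w : 'I_n -> A)
    (p : {mpoly A[n]}) :
  p \is 1.-homog -> p.@[w] = \sum_(i < n) p@_U_(i) * w i.
Proof. exact: mmap_linear_form. Qed.

(** * Hyperplanes *)

Section Hyperplanes.

Variables (K : fieldType) (n : nat).
Implicit Types (p : {mpoly K[n.+1]}) (U W : {vspace 'rV[K]_n.+1}).

(** The kernel is taken of a linear map with values in ['rV_1], which makes
    the rank-nullity theorem for [{vspace _}] applicable. *)
Definition form_map p : 'Hom('rV[K]_n.+1, 'rV[K]_1) :=
  linfun (mulmxr (\col_i p@_U_(i))).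

Definition form_kernel p : {vspace 'rV[K]_n.+1} := lker (form_map p).

Lemma mem_form_kernel p (v : 'rV[K]_n.+1) :
  p \is 1.-homog -> (v \in form_kernel p) = (p.@[v 0] == 0).
Proof.
move=> p_lin; rewrite memv_ker lfunE /= (meval_linear_form _ p_lin).
have -> : \sum_i p@_U_(i) * v 0 i = (v *m \col_i p@_U_(i)) 0 0.
  by rewrite mxE; apply: eq_bigr => i _; rewrite mxE mulrC.
apply/eqP/eqP => [->|v0]; first by rewrite mxE.
by apply/matrixP => i j; rewrite !ord1 v0 mxE.
Qed.

Lemma dim_form_kernel p : (n <= \dim (form_kernel p))%N.
Proof.
have := limg_ker_dim (form_map p) fullv.
have := dimvS (subvf (form_map p @: fullv)%VS).
rewrite capfv !dimvf !dim_matrix !mul1r -/(form_kernel p) => le1 eq_n.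
have : (n.+1 <= \dim (form_kernel p) + 1)%N.
  by rewrite -[leqLHS]eq_n leq_add2l.
by rewrite addn1 ltnS.
Qed.

Lemma projlin_subset U W : projlin U `<=` projlin W -> (U <= W)%VS.
Proof.
move=> sUW; apply/subvP => v vU; have [->|v_neq0] := eqVneq v 0.
  exact: mem0v.
have dim_v : \dim <[v]>%VS == 1%N by rewrite dim_vline v_neq0.
have := sUW (exist (fun L => \dim L == 1%N) <[v]>%VS dim_v).
by rewrite /projlin /= -!memvE; apply.
Qed.

Lemma projzeros_linear_form p :
  p \is 1.-homog -> projzeros p = projlin (form_kernel p).
Proof.
move=> p_lin; apply/seteqP; split=> x /= px.
  by apply/subvP => v /px; rewrite mem_form_kernel // => /eqP.
by move=> v /(subvP px); rewrite mem_form_kernel // => /eqP.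
Qed.

(** The zeros of [p] are a subspace of linear dimension at least [n], hence
    larger than the plane, of dimension 3, that would contain them if [q]
    vanished on all of them. *)
Lemma projzeros_not_subset p q :
    p \is 1.-homog -> q \is 1.-homog -> (3 < n)%N ->
    is_plane (projzeros p `&` projzeros q) ->
  exists v : 'rV[K]_n.+1, p.@[v 0] = 0 /\ q.@[v 0] != 0.
Proof.
move=> p_lin q_lin n_gt3 [W dimW].
rewrite !projzeros_linear_form // => pqW.
suff /subvPn[v] : ~~ (form_kernel p <= form_kernel q)%VS.
  by rewrite !mem_form_kernel // => /eqP; exists v.
apply/negP => spq; suff /dimvS : (form_kernel p <= W)%VS.
  by rewrite dimW leqNgt (leq_trans n_gt3) ?dim_form_kernel.
apply: projlin_subset; rewrite -pqW => x px.
by split=> //; apply: subv_trans spq.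
Qed.

(** Polynomials modulo a linear form [f] form a domain, and no [g j] is zero in
    it. To use only the domain [{poly K}], over any field, the forms
    are restricted to the curve [\sum_j t ^ j v_j], with [v_j] a zero of [f] but
    not of [g j]: [f] restricts to 0, while the restriction of [g j] has the
    value of [g j] at [v_j] as its coefficient of degree [j]. *)
Lemma linear_form_ndvd_prod (m : nat) (f : {mpoly K[n.+1]})
    (g : 'I_m -> {mpoly K[n.+1]}) :
    f \is 1.-homog -> (forall j, g j \is 1.-homog) ->
    (forall j, exists v : 'rV[K]_n.+1, f.@[v 0] = 0 /\ (g j).@[v 0] != 0) ->
  ~ mpoly_dvd f (\prod_j g j).
Proof.
move=> f_lin g_lin /choice[v vP] [r g_eq].
pose w i : {poly K} := \sum_j (v j 0 i)%:P * 'X^j.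
pose restr := mmap (@polyC K) w : {mpoly K[n.+1]} -> {poly K}.
(* The bound index of [\poly] is a natural number, and [insub] turns it back
   into an index of the family [v]. *)
have restrE p : p \is 1.-homog -> restr p =
    \poly_(j < m) (if insub j is Some k then p.@[v k 0] else 0).
  move=> p_lin; rewrite /restr mmap_linear_form // poly_def.
  under [RHS]eq_bigr => j _ do
    rewrite valK (meval_linear_form _ p_lin) scaler_suml.
  rewrite exchange_big; apply: eq_bigr => i _; rewrite mulr_sumr.
  by apply: eq_bigr => j _; rewrite mulrA -polyCM mul_polyC.
have restr_f : restr f = 0.
  rewrite restrE //; apply/polyP => j; rewrite coef_poly coef0.
  by case: ifP => // _; case: insubP => // k _ _; case: (vP k).
have restr_g j : restr (g j) != 0.
  rewrite restrE //; apply/eqP => /polyP/(_ j).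
  rewrite coef_poly ltn_ord valK coef0; exact/eqP/(vP j).2.
have : restr (\prod_j g j) = 0.
  by rewrite g_eq /restr rmorphM /= -/(restr f) restr_f mul0r.
rewrite /restr rmorph_prod /= => /eqP; rewrite prodf_seq_eq0.
by case/hasP=> j _ /= /idPn; rewrite restr_g.
Qed.

End Hyperplanes.

(** * Expansion of the product of the differences *)

(** [Viete] is an identity with integer coefficients; in this form it can be
    specialized to [f]. *)
Lemma elem_sym_mmap (K : fieldType) (n m r : nat) (f : 'I_m -> {mpoly K[n]}) :
  elem_sym r f = mmap intr f (mesym m int r).
Proof.
rewrite /elem_sym !mesymE !raddf_sum /=; apply: eq_bigr => S _.
rewrite comp_mpolyX mmapX.
by apply: eq_bigr => i _; rewrite tnth_mktuple.
Qed.

Lemma prod_sub_elem_sym (K : fieldType) (n m : nat)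
    (f : 'I_m -> {mpoly K[n]}) (h : {mpoly K[n]}) :
  \prod_i (h - f i) =
    \sum_(k < m.+1) (-1) ^+ k * (elem_sym k f * h ^+ (m - k)).
Proof.
pose ev (p : {poly {mpoly int[m]}}) := (map_poly (mmap intr f) p).[h].
have := congr1 ev (Viete m); rewrite /ev rmorph_prod raddf_sum /=.
rewrite horner_prod horner_sum.
under eq_bigr => i _ do
  rewrite raddfB /= map_polyX map_polyC /= mmapX mmap1U hornerXsubC.
move=> ->; apply: eq_bigr => k _.
rewrite !map_polyZ /= map_polyXn !hornerZ hornerXn elem_sym_mmap.
by rewrite rmorphXn /= rmorphN1.
Qed.

Lemma elem_sym_prod (K : fieldType) (n m : nat) (f : 'I_m -> {mpoly K[n]}) :
  elem_sym m f = \prod_i f i.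
Proof.
rewrite elem_sym_mmap mesymnnE rmorph_prod /=.
by apply: eq_bigr => i _; rewrite mmapX mmap1U.
Qed.

(** The left-hand side has the exact shape of the unfolded sum of
    [prod_sub_elem_sym]. The ring is abstract because normalization by [ring] is
    too slow on multivariate polynomials. *)
Lemma alternating_sum4 (A : comNzRingType) (h e1 e2 e3 e4 : A) :
  e4 - ((-1) ^+ 0 * (1 * h ^+ 4) + (-1) ^+ 1 * (e1 * h ^+ 3)
        + (-1) ^+ 2 * (e2 * h ^+ 2) + (-1) ^+ 3 * (e3 * h ^+ 1)
        + (-1) ^+ 4 * (e4 * h ^+ 0)) =
  h * (e3 - h * e2 + h ^+ 2 * e1 - h ^+ 3).
Proof. ring. Qed.

Lemma prod_sub_prod_elem_sym4 (K : fieldType) (n : nat)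
    (f : 'I_4 -> {mpoly K[n]}) (h : {mpoly K[n]}) :
  \prod_i f i - \prod_i (h - f i) =
  h * (elem_sym 3 f - h * elem_sym 2 f + h ^+ 2 * elem_sym 1 f - h ^+ 3).
Proof.
have elem_sym0 : elem_sym 0 f = 1 by rewrite /elem_sym mesym0E comp_mpoly1.
rewrite -elem_sym_prod prod_sub_elem_sym.
rewrite !big_ord_recr big_ord0 /= add0r elem_sym0.
exact: alternating_sum4.
Qed.

(** * The cubic *)

Definition cubic (A : pzRingType) (f : 'I_4 -> A) (h : A) : A :=
  f 0 * f 1 * f 2 + f 0 * f 1 * f 3 + f 0 * f 2 * f 3 + f 1 * f 2 * f 3
  - h * (f 0 * f 1 + f 0 * f 2 + f 0 * f 3 + f 1 * f 2 + f 1 * f 3 + f 2 * f 3)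
  + h ^+ 2 * (f 0 + f 1 + f 2 + f 3) - h ^+ 3.

Lemma prod4E (A : comPzRingType) (f : 'I_4 -> A) :
  \prod_i f i = f 0 * f 1 * f 2 * f 3.
Proof.
rewrite !big_ord_recr big_ord0 /= mul1r.
by congr (f _ * f _ * f _ * f _); apply/val_inj.
Qed.

Lemma prod_sub_prod_cubic (A : comNzRingType) (f : 'I_4 -> A) (h : A) :
  \prod_i f i - \prod_i (h - f i) = h * cubic f h.
Proof. rewrite !prod4E /cubic; ring. Qed.

(** If [f i = 0] and [f j = h], with [a] and [b] the two other forms, then
    [e_1 = h + a + b], [e_2 = h (a + b) + a b] and [e_3 = h a b], and the
    alternating sum cancels. *)
Lemma cubic_residual (A : comNzRingType) (f : 'I_4 -> A) (h : A) (i j : 'I_4) :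
  i != j -> f i = 0 -> f j = h -> cubic f h = 0.
Proof.
rewrite /cubic.
have ordE k : [\/ k = 0, k = 1, k = 2 | k = 3 :> 'I_4].
  case: k => [[|[|[|[|//]]]] lt_k];
    by [constructor 1; apply/val_inj | constructor 2; apply/val_inj
       | constructor 3; apply/val_inj | constructor 4; apply/val_inj].
by case: (ordE i) => ->; case: (ordE j) => -> // _ -> ->; ring.
Qed.

Theorem theorem2 (R : realType)
    (f g : 'I_4 -> {mpoly R[i][5]}) (h : {mpoly R[i][5]})
    (f_lin : forall i, f i \is 1.-homog) (f_neq0 : forall i, f i != 0)
    (g_lin : forall i, g i \is 1.-homog) (g_neq0 : forall i, g i != 0)
    (h_lin : h \is 1.-homog) (h_neq0 : h != 0)
    (Pi_plane : forall i j, is_plane (projzeros (f i) `&` projzeros (g j)))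
    (Pi_diag : forall i, projzeros (f i) `&` projzeros (g i) `<=` projzeros h)
    (H_neqF : forall i, projzeros h <> projzeros (f i))
    (H_neqG : forall i, projzeros h <> projzeros (g i))
    (h_sum : forall i, h = f i + g i) :
  mpoly_dvd h (\prod_(i < 4) f i - \prod_(i < 4) g i) /\
  (forall q : {mpoly R[i][5]},
     \prod_(i < 4) f i - \prod_(i < 4) g i = h * q ->
     [/\ q \is 3.-homog /\ q != 0,
         forall i j, i != j ->
           projzeros (f i) `&` projzeros (g j) `<=` projzeros q,
         q = elem_sym 3 f - h * elem_sym 2 f + h ^+ 2 * elem_sym 1 f - h ^+ 3
       & q = f 0 * f 1 * f 2 + f 0 * f 1 * f 3 + f 0 * f 2 * f 3
               + f 1 * f 2 * f 3
             - h * (f 0 * f 1 + f 0 * f 2 + f 0 * f 3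
                    + f 1 * f 2 + f 1 * f 3 + f 2 * f 3)
             + h ^+ 2 * (f 0 + f 1 + f 2 + f 3)
             - h ^+ 3]).
Proof.
have g_def i : g i = h - f i by rewrite (h_sum i) addrAC subrr add0r.
have prod_g : \prod_(i < 4) g i = \prod_i (h - f i) by apply: eq_bigr.
split=> [|q q_def].
  by exists (cubic f h); rewrite prod_g prod_sub_prod_cubic.
have qE : q = cubic f h.
  by apply: (mulfI h_neq0); rewrite -q_def prod_g prod_sub_prod_cubic.
have q_neq0 : q != 0.
  apply/eqP => q0; move/eqP: q_def; rewrite q0 mulr0 subr_eq0 => /eqP prod_eq.
  case: (linear_form_ndvd_prod (f_lin 0) g_lin) => [j|].
    exact: (projzeros_not_subset (f_lin 0) (g_lin j) _ (Pi_plane 0 j)).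
  by exists (\prod_(i < 3) f (lift ord0 i)); rewrite -prod_eq big_ord_recl.
split; [split=> // | | | exact: qE].
- have hom2 (a b : {mpoly R[i][5]}) :
    a \is 1.-homog -> b \is 1.-homog -> a * b \is 2.-homog.
    exact: (@dhomogM _ _ _ 1 _ 1).
  have hom3 (a b : {mpoly R[i][5]}) :
    a \is 2.-homog -> b \is 1.-homog -> a * b \is 3.-homog.
    exact: (@dhomogM _ _ _ 2 _ 1).
  have hom3' (a b : {mpoly R[i][5]}) :
    a \is 1.-homog -> b \is 2.-homog -> a * b \is 3.-homog.
    exact: (@dhomogM _ _ _ 1 _ 2).
  rewrite qE /cubic (exprS h 2) expr2.
  apply: rpredB; last by apply/hom3'/hom2.
  apply: rpredD; last by apply: hom3; [exact: hom2 | rewrite !rpredD].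
  apply: rpredB; first by rewrite !rpredD // hom3 // hom2.
  by apply: hom3' => //; rewrite !rpredD // hom2.
- move=> i j ne_ij x [/= fx gx] v vx; rewrite qE.
  have -> : (cubic f h).@[v 0] = cubic (fun k => (f k).@[v 0]) h.@[v 0].
    by rewrite /cubic !(rmorphB, rmorphD, rmorphM, rmorphXn) /=.
  apply: (cubic_residual ne_ij); first exact: fx.
  by rewrite (h_sum j) mevalD (gx v vx) addr0.
- by apply: (mulfI h_neq0); rewrite -q_def prod_g prod_sub_prod_elem_sym4.
Qed.
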